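(* Let $0<\alpha<10^{-5}$ and let $G$ be a graph with $n$ vertices and $m$ edges, where $m\ge\left(\frac14-\alpha\right)n^2$. Then either \[ bk(G)>\left(\frac16-2\alpha^{1/3}\right)n, \] or $G$ contains an induced bipartite subgraph $G_1$ with at least $\left(1-\alpha^{1/3}\right)n$ vertices and minimum degree \[ \delta(G_1)\ge\left(\frac12-4\alpha^{1/3}\right)n. \]
   Context: A book of size $q$ is a set of $q$ triangles sharing a common edge; the booksize $bk(G)$ is the size of the largest book in $G$, i.e. the maximum over edges $uv$ of the number of common neighbours of $u$ and $v$. $\delta(H)$ is the minimum degree of a graph $H$. *)

(* Defs.v *)
From mathcomp Require Import all_boot.
From Stdlib Require Import Reals.
Set Implicit Arguments. Unset Strict Implicit. Unset Printing Implicit Defensive.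

Definition simple_graph (T : finType) (e : rel T) : Prop :=
  symmetric e /\ irreflexive e.

Definition num_edges (T : finType) (e : rel T) : nat :=
  #|[set A : {set T} | [exists x, exists y, (A == [set x; y]) && e x y]]|.

Definition common_nbrs (T : finType) (e : rel T) (u v : T) : {set T} :=
  [set w | e u w && e v w].

(* Booksize: maximum over edges uv of the number of common neighbours
   (0 if there are no edges). *)
Definition booksize (T : finType) (e : rel T) : nat :=
  \max_(p : T * T | e p.1 p.2) #|common_nbrs e p.1 p.2|.

Definition induced_bipartite (T : finType) (e : rel T) (S : {set T}) : Prop :=
  exists A B : {set T},
    [/\ A :|: B = S, [disjoint A & B],
        (forall x y, x \in A -> y \in A -> ~~ e x y) &
        (forall x y, x \in B -> y \in B -> ~~ e x y)].

Definition induced_deg (T : finType) (e : rel T) (S : {set T}) (v : T) : nat :=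
  #|[set w in S | e v w]|.

(* Main.v *)
Require Import Defs.
From mathcomp Require Import all_boot.
From mathcomp Require Import zify.
From Stdlib Require Import Reals Lra.
Set Implicit Arguments. Unset Strict Implicit. Unset Printing Implicit Defensive.

(** Let [b = bk(G)].  In a triangle the three codegrees add up to at least
    [d(u) + d(v) + d(w) - n]; summing this over all triangles and combining it
    with the sum over all edges of [(b - c(uv)) (n + c(uv) - d(u) - d(v)) >= 0],
    where [c] is the codegree, gives [\sum_v d(v)^2 <= n m] as soon as
    [6 b <= n].  So if [m >= (1/4 - alpha) n^2], the degrees have variance at
    most [alpha n^2] about [n/2], and with [x := alpha^(1/3)] all but at most
    [x n] vertices have degree at least [(1/2 - x) n].  Those vertices span no
    triangle, since some edge of such a triangle would have codegree at least
    [(1/6 - x) n > b].  They therefore span a triangle-free graph of minimum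
    degree at least [(1/2 - 2 x) n], which exceeds 3/7 of its order and so
    forces it to be bipartite. *)

(** * Degrees and codegrees *)

Definition degree (T : finType) (e : rel T) (v : T) : nat := #|[set w | e v w]|.

Lemma card_set_sum (T : finType) (P : pred T) : #|[set x | P x]| = \sum_x P x.
Proof.
rewrite -sum1_card big_mkcond; apply: eq_bigr => x _.
by rewrite inE; case: (P x).
Qed.

(** An element of exactly [k] of the three sets lies in [k(k-1)/2] pairwise intersections, and
    [k <= 1 + k(k-1)/2]. *)
Lemma cardsU3_ge (T : finType) (A B C : {set T}) :
  #|A| + #|B| + #|C| <= #|T| + #|A :&: B| + #|A :&: C| + #|B :&: C|.
Proof.
have := cardsUI A B; have := cardsUI (A :|: B) C.
have := cardsUI (A :&: C) (B :&: C); rewrite setIUl.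
have : #|A :|: B :|: C| <= #|T| by exact: max_card.
lia.
Qed.

Lemma common_nbrsE (T : finType) (e : rel T) (u v : T) :
  common_nbrs e u v = [set w | e u w] :&: [set w | e v w].
Proof. by apply/setP => w; rewrite !inE. Qed.

Lemma codegree_ge (T : finType) (e : rel T) (u v : T) :
  degree e u + degree e v <= #|T| + #|common_nbrs e u v|.
Proof.
rewrite common_nbrsE /degree; have := cardsUI [set w | e u w] [set w | e v w].
have : #|[set w | e u w] :|: [set w | e v w]| <= #|T| by exact: max_card.
lia.
Qed.

Lemma codegree_triple_ge (T : finType) (e : rel T) (u v w : T) :
  degree e u + degree e v + degree e w <=
  #|T| + #|common_nbrs e u v| + #|common_nbrs e u w| + #|common_nbrs e v w|.
Proof. by rewrite !common_nbrsE; exact: cardsU3_ge. Qed.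

Lemma codegree_le_booksize (T : finType) (e : rel T) (u v : T) :
  e u v -> #|common_nbrs e u v| <= booksize e.
Proof.
exact: (@leq_bigmax_cond _ (fun p : T * T => e p.1 p.2)
  (fun p => #|common_nbrs e p.1 p.2|) (u, v)).
Qed.

(** * Double counting over triangles *)

(** The codegree of [u v] counts the triangles on that edge. Renaming the vertices of an ordered
    triangle shows that each of its three edges contributes the same total. *)
Lemma triangle_sum (T : finType) (e : rel T) (F : T -> T -> nat) :
  symmetric e ->
  3 * (\sum_u \sum_v e u v * (#|common_nbrs e u v| * F u v)) =
  \sum_u \sum_v \sum_w e u v * e u w * e v w * (F u v + F u w + F v w).
Proof.
move=> sym_e.
set s := \sum_u _.
have s12 : \sum_u \sum_v \sum_w e u v * e u w * e v w * F u v = s.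
  apply: eq_bigr => u _; apply: eq_bigr => v _.
  rewrite card_set_sum big_distrl /= big_distrr /=; apply: eq_bigr => w _.
  by case: (e u v); case: (e u w); case: (e v w); rewrite /= ?(mul0n, mul1n).
have s13 : \sum_u \sum_v \sum_w e u v * e u w * e v w * F u w = s.
  rewrite -s12; apply: eq_bigr => u _; rewrite exchange_big /=.
  apply: eq_bigr => v _; apply: eq_bigr => w _.
  by rewrite (sym_e w v) (mulnC (e u w)).
have s23 : \sum_u \sum_v \sum_w e u v * e u w * e v w * F v w = s.
  rewrite -s12 exchange_big /=; apply: eq_bigr => v _.
  rewrite exchange_big /=; apply: eq_bigr => w _; apply: eq_bigr => u _.
  rewrite (sym_e u v) (sym_e u w); congr (_ * _).
  by rewrite mulnC mulnA.
have -> : 3 * s = s + s + s by lia.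
rewrite -{1}s12 -{1}s13 -s23 -!big_split /=.
apply: eq_bigr => u _; rewrite -!big_split /=; apply: eq_bigr => v _.
by rewrite -!big_split /=; apply: eq_bigr => w _; rewrite !mulnDr.
Qed.

Lemma triangle_codegree_sum (T : finType) (e : rel T) :
  symmetric e ->
  3 * (\sum_u \sum_v e u v * (#|common_nbrs e u v| * (degree e u + degree e v)))
  <= 6 * (\sum_u \sum_v e u v * (#|common_nbrs e u v| * #|common_nbrs e u v|))
     + 2 * (#|T| * \sum_u \sum_v e u v * #|common_nbrs e u v|).
Proof.
move=> sym_e; pose c u v := #|common_nbrs e u v|.
(* Over the three edges of a triangle this weight adds up to 6 times the right side of
   [codegree_triple_ge], while the weight [degree e u + degree e v], tripled, adds up to 6 times its
   left side. *)
have := triangle_sum (fun u v => 6 * c u v + 2 * #|T|) sym_e.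
have -> : \sum_u \sum_v e u v * (c u v * (6 * c u v + 2 * #|T|)) =
    6 * (\sum_u \sum_v e u v * (c u v * c u v)) +
    2 * (#|T| * \sum_u \sum_v e u v * c u v).
  rewrite !big_distrr -big_split /=; apply: eq_bigr => u _.
  rewrite !big_distrr -big_split /=; apply: eq_bigr => v _.
  by case: (e u v) => /=; lia.
move=> E; rewrite -(@leq_pmul2l 3) // E triangle_sum // big_distrr /=.
apply: leq_sum => u _; rewrite big_distrr /=; apply: leq_sum => v _.
rewrite big_distrr /=; apply: leq_sum => w _.
rewrite mulnCA leq_mul2l; apply/orP; right.
have := codegree_triple_ge e u v w; rewrite /c /=; lia.
Qed.

Lemma sum_degree_sqr (T : finType) (e : rel T) :
  symmetric e ->
  \sum_u \sum_v e u v * (degree e u + degree e v) =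
  2 * \sum_v degree e v * degree e v.
Proof.
move=> sym_e; pose s := \sum_v degree e v * degree e v.
have sl : \sum_u \sum_v e u v * degree e u = s.
  by apply: eq_bigr => u _; rewrite -big_distrl /= -card_set_sum.
have sr : \sum_u \sum_v e u v * degree e v = s.
  rewrite exchange_big -sl /=; apply: eq_bigr => u _; apply: eq_bigr => v _.
  by rewrite sym_e.
rewrite -/s mul2n -addnn -{1}sl -sr -big_split; apply: eq_bigr => u _.
by rewrite -big_split; apply: eq_bigr => v _; rewrite mulnDr.
Qed.

Lemma sum_degree_sqr_le (T : finType) (e : rel T) :
  symmetric e -> 6 * booksize e <= #|T| ->
  2 * (\sum_v degree e v * degree e v) <= #|T| * \sum_v degree e v.
Proof.
move=> sym_e; set b := booksize e; set n := #|T| => le_bn.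
pose c u v := #|common_nbrs e u v|.
have Ed : \sum_v degree e v = \sum_u \sum_v e u v.
  by apply: eq_bigr => u _; rewrite /degree card_set_sum.
rewrite -sum_degree_sqr // Ed.
(* The main argument cancels a factor [b]. If [b = 0], all codegrees of edges vanish and
   [d(u) + d(v) <= n] holds edge by edge. *)
have [b0 | b_gt0] := posnP b.
  rewrite big_distrr; apply: leq_sum => u _.
  rewrite big_distrr; apply: leq_sum => v _ /=.
  case euv: (e u v) => //=; have := codegree_ge e u v.
  by have := codegree_le_booksize euv; rewrite -/b b0 /n; lia.
have tri : 3 * (\sum_u \sum_v e u v * (c u v * (degree e u + degree e v)))
  <= 6 * (\sum_u \sum_v e u v * (c u v * c u v))
     + 2 * (n * \sum_u \sum_v e u v * c u v) := triangle_codegree_sum sym_e.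
have cc_le : \sum_u \sum_v e u v * (c u v * c u v)
  <= b * \sum_u \sum_v e u v * c u v.
  rewrite big_distrr; apply: leq_sum => u _.
  rewrite big_distrr; apply: leq_sum => v _ /=.
  case euv: (e u v) => //=; rewrite !mul1n leq_mul2r.
  by rewrite codegree_le_booksize ?orbT.
have mixed :
  b * (\sum_u \sum_v e u v * (degree e u + degree e v))
    + n * (\sum_u \sum_v e u v * c u v)
    + \sum_u \sum_v e u v * (c u v * c u v)
  <= b * (n * \sum_u \sum_v e u v)
    + b * (\sum_u \sum_v e u v * c u v)
    + \sum_u \sum_v e u v * (c u v * (degree e u + degree e v)).
  rewrite !big_distrr -!big_split; apply: leq_sum => u _ /=.
  rewrite !big_distrr -!big_split; apply: leq_sum => v _ /=.
  case euv: (e u v); last by rewrite !mul0n !muln0.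
  have := codegree_ge e u v; have := codegree_le_booksize euv.
  rewrite -/b -/n -/(c u v); move: (c u v) (degree e u) (degree e v) => *; nia.
(* With S, E, C the edge sums of [d(u) + d(v)], 1 and [c], eliminating the other two sums by [tri]
   and [cc_le] turns [mixed] into [b S <= b n E + (2b - n/3) C], and [6b <= n]. *)
rewrite -(leq_pmul2l b_gt0).
have := leq_mul le_bn (leqnn (\sum_u \sum_v e u v * c u v)); lia.
Qed.

(** * Edge count and vertices of low degree *)

(** Ordered adjacent pairs are grouped by their underlying set; each edge receives both of its
    orientations, which differ by irreflexivity. *)
Lemma num_edges_le (T : finType) (e : rel T) :
  simple_graph e -> 2 * num_edges e <= \sum_v degree e v.
Proof.
case=> sym_e irr_e.
have -> : \sum_v degree e v = \sum_(p : T * T | e p.1 p.2) 1.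
  rewrite -(pair_big_dep xpredT (fun u v => e u v) (fun _ _ => 1)) /=.
  by apply: eq_bigr => u _; rewrite /degree -sum1_card; apply: eq_bigl => v;
    rewrite inE.
rewrite /num_edges; set E := [set A | _].
rewrite (partition_big (fun p => [set p.1; p.2]) (mem E)) /=; last first.
  by move=> [x y] /= exy; rewrite inE; apply/existsP; exists x;
     apply/existsP; exists y; rewrite eqxx.
rewrite mulnC -sum_nat_const; apply: leq_sum => A.
rewrite inE => /existsP[x /existsP[y /andP[/eqP-> exy]]].
have nxy : x != y by apply: contraTneq exy => ->; rewrite irr_e.
rewrite sum1_card; have <- : #|[set (x, y); (y, x)]| = 2.
  by rewrite cards2 xpair_eqE (negbTE nxy).
apply: subset_leq_card; apply/subsetP => p; rewrite !inE.
case/orP => /eqP ->; rewrite unfold_in /=; first by rewrite exy eqxx.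
by rewrite sym_e exy setUC eqxx.
Qed.

(* Sum [(n - 2 d(v))^2 >= g^2 1_L(v)] over all vertices; subtraction-free. *)
Lemma low_degree_bound (T : finType) (e : rel T) (L : {set T}) (g : nat) :
  simple_graph e -> 6 * booksize e <= #|T| ->
  (forall v, v \in L -> 2 * degree e v + g <= #|T|) ->
  g * g * #|L| + 4 * (#|T| * num_edges e) <= #|T| * (#|T| * #|T|).
Proof.
move=> simple_e le_bn low; have [sym_e _] := simple_e.
have := num_edges_le simple_e; have := sum_degree_sqr_le sym_e le_bn.
set n := #|T|; set m := num_edges e => sqr_le m_le.
have sum_sqr : \sum_v (g * g * (v \in L) + 4 * (n * degree e v)) <=
    \sum_(v : T) (n * n + 4 * (degree e v * degree e v)).
  apply: leq_sum => v _; case vL: (v \in L).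
    have := low v vL; rewrite -/n muln1; move: (degree e v) => d le_dn.
    have -> : n = 2 * d + g + (n - (2 * d + g)) by rewrite subnKC.
    move: (n - _) => k; have := leq0n (g * k); have := leq0n (k * k); lia.
  rewrite muln0; have := (nat_Cauchy n (2 * degree e v)).1; lia.
move: sum_sqr; rewrite !big_split !sum_nat_const -!big_distrr /= -card_set_sum.
rewrite cardsE -[#|xpredT|]/n.
(* By [sqr_le] the summed inequality leaves [g^2 |L| + 2n D <= n^3], where D is the degree sum, and
   [2m <= D]. *)
have := leq_mul (leqnn n) m_le; lia.
Qed.

(** * Dense triangle-free graphs are bipartite *)

(** For an edge [u v], the neighbourhoods of [u] and [v] are disjoint and fill over 6/7 of [M].
    Every vertex has neighbours in only one of them, which determines its side. *)
Lemma dense_triangle_free_bipartite (T : finType) (e : rel T) (M : {set T}) :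
  symmetric e ->
  (forall u v w, u \in M -> v \in M -> w \in M ->
     e u v -> e u w -> e v w -> False) ->
  (forall v, v \in M -> 3 * #|M| < 7 * induced_deg e M v) ->
  induced_bipartite e M.
Proof.
move=> sym_e no_tri dense; pose N v := [set w in M | e v w].
have [-> | [u uM]] := set_0Vmem M.
  exists set0, set0; split=> //; rewrite ?setU0 // ?disjoints_subset ?sub0set //;
    by move=> x y; rewrite inE.
have [v] : exists v, v \in N u.
  by apply/card_gt0P; have := dense u uM; rewrite /induced_deg -/(N u); clear; lia.
rewrite inE => /andP[vM euv].
have NM w : N w \subset M by apply/subsetP => x; rewrite inE => /andP[].
have N_indep w x y : w \in M -> x \in N w -> y \in N w -> ~~ e x y.
  move=> wM; rewrite !inE => /andP[xM ewx] /andP[yM ewy].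
  by apply/negP; apply: (no_tri w x y).
have disjN x y : x \in M -> y \in M -> e x y -> N x :&: N y = set0.
  move=> xM yM exy; apply/setP => w; rewrite !inE; apply/negP.
  case/andP=> /andP[wM exw] /andP[_ eyw]; exact: (no_tri x y w).
have cardUM (X Y : {set T}) : X \subset M -> Y \subset M -> X :&: Y = set0 ->
    #|X| + #|Y| <= #|M|.
  move=> XM YM XY0; rewrite -cardsUI XY0 cards0 addn0.
  by apply: subset_leq_card; rewrite subUset XM.
have split_card w :
    #|N w| + #|N u| + #|N v| <= #|M| + #|N w :&: N u| + #|N w :&: N v|.
  have := cardsUI (N w) (N u :|: N v); have := cardsUI (N u) (N v).
  rewrite disjN // cards0 setIUr.
  have := cardsUI (N w :&: N u) (N w :&: N v).
  have : #|N w :|: (N u :|: N v)| <= #|M|.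
    by apply: subset_leq_card; rewrite !subUset !NM.
  clear; lia.
have degN w : w \in M -> 3 * #|M| < 7 * #|N w| by move=> wM; exact: dense.
(* [x] has no neighbour in [N z], nor in the part of [N w] inside [N z']. *)
have far w z z' x : w \in M -> z \in M -> z' \in M -> e z z' ->
    x \in N w :&: N z -> #|N x| + #|N z| + #|N w :&: N z'| <= #|M|.
  move=> wM zM z'M ezz' /setIP[xNw xNz].
  have xM : x \in M by exact: (subsetP (NM w)).
  have N0 : N z :&: (N w :&: N z') = set0.
    by rewrite setICA disjN // setI0.
  have Nx0 : N x :&: (N z :|: N w :&: N z') = set0.
    apply/setP => y; rewrite in_set0 in_setI; apply/negP => /andP[].
    rewrite inE => /andP[_ exy] /setUP[yNz | /setIP[yNw _]].
      by move/negP: (N_indep z x y zM xNz yNz).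
    by move/negP: (N_indep w x y wM xNw yNw).
  have sub : N z :|: N w :&: N z' \subset M.
    by rewrite subUset NM subIset ?NM.
  by have := cardUM _ _ (NM x) sub Nx0; have := cardsUI (N z) (N w :&: N z');
    rewrite N0 cards0; clear; lia.
have evu : e v u by rewrite sym_e.
have one_side w : w \in M -> N w :&: N u = set0 \/ N w :&: N v = set0.
  move=> wM.
  have [-> | [x xu]] := set_0Vmem (N w :&: N u); first by left.
  have [-> | [y yv]] := set_0Vmem (N w :&: N v); first by right.
  have xM : x \in M by case/setIP: xu => _; exact: (subsetP (NM u)).
  have yM : y \in M by case/setIP: yv => _; exact: (subsetP (NM v)).
  (* Adding these two bounds to [split_card] gives [|N x| + |N y| + |N w| + 2|N u| + 2|N v| <=
     3|M|]: seven degrees, each above 3/7 of [|M|]. *)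
  have := far w u v x wM uM vM euv xu; have := far w v u y wM vM uM evu yv.
  have := split_card w; have := degN w wM; have := degN u uM.
  by have := degN v vM; have := degN x xM; have := degN y yM; clear; lia.
(* A vertex with no neighbour in [N z] is adjacent to more than half of [N z'],
   so two such vertices have a common neighbour. *)
have indep z z' x y : z' \in M ->
    (forall w, #|N w| + #|N z| + #|N z'| <=
       #|M| + #|N w :&: N z| + #|N w :&: N z'|) ->
    z \in M -> x \in M -> y \in M ->
    N x :&: N z = set0 -> N y :&: N z = set0 -> ~~ e x y.
  move=> z'M split_z zM xM yM x0 y0; apply/negP => exy.
  have := split_z x; have := split_z y; rewrite x0 y0 cards0 !addn0.
  have XY0 : (N x :&: N z') :&: (N y :&: N z') = set0.
    by rewrite setIACA disjN // set0I.
  have := cardsUI (N x :&: N z') (N y :&: N z'); rewrite XY0 cards0.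
  have : #|N x :&: N z' :|: N y :&: N z'| <= #|N z'|.
    by apply: subset_leq_card; rewrite -setIUl subsetIr.
  have [t tz'] : exists t, t \in N z'.
    by apply/card_gt0P; have := degN z' z'M; clear; lia.
  have tM : t \in M by exact: (subsetP (NM z')).
  have Nt0 : N t :&: N z' = set0.
    by apply: disjN => //; move: tz'; rewrite inE sym_e => /andP[].
  have := cardUM _ _ (NM t) (NM z') Nt0.
  have := degN t tM; have := degN x xM; have := degN y yM.
  by have := degN z zM; have := degN z' z'M; clear; lia.
(* By [one_side] these cover [M]. For a vertex [w] in both, [N w], [N u] and [N v] would be
   disjoint, of total size above 9/7 of [|M|]. *)
exists [set w in M | N w :&: N u == set0], [set w in M | N w :&: N v == set0].
split.
- apply/setP => w; rewrite !inE; case wM: (w \in M) => //=.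
  by apply/orP; case: (one_side w wM) => ->; [left | right].
- apply/pred0P => w /=; rewrite !inE; apply/negP.
  case/andP => /andP[wM /eqP w0] /andP[_ /eqP w1].
  have := split_card w; rewrite w0 w1 cards0.
  by have := degN w wM; have := degN u uM; have := degN v vM; clear; lia.
- move=> x y; rewrite !inE => /andP[xM /eqP x0] /andP[yM /eqP y0].
  exact: (indep u v).
- move=> x y; rewrite !inE => /andP[xM /eqP x0] /andP[yM /eqP y0].
  apply: (indep v u) => // w; have := split_card w; clear; lia.
Qed.

(** * Real estimates and the final choice of subgraph *)

Open Scope R_scope.

Lemma Rpower_third_pow3 (x : R) : 0 < x -> Rpower x (/ 3) ^ 3 = x.
Proof.
move=> x_gt0; rewrite -Rpower_pow; last exact: exp_pos.
rewrite Rpower_mult; have -> : / 3 * INR 3 = 1 by rewrite /=; field.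
exact: Rpower_1.
Qed.

(** A Chebyshev estimate: [g^2 |L| <= n^3 - 4nm <= 4 x^3 n^3] with [g > 2xn]. The cube makes the
    tolerance on the degree and the fraction of exceptions both equal to [x]. *)
Lemma few_low_degrees (T : finType) (e : rel T) (x : R) (L : {set T}) :
  simple_graph e -> (6 * booksize e <= #|T|)%nat -> 0 < x ->
  INR (num_edges e) >= (/ 4 - x ^ 3) * INR #|T| ^ 2 ->
  (forall v, v \in L -> INR (degree e v) < (/ 2 - x) * INR #|T|) ->
  INR #|L| <= x * INR #|T|.
Proof.
move=> simple_e le_bn x_gt0 m_ge low.
have [-> | [v0 v0L]] := set_0Vmem L.
  by rewrite cards0; apply: Rmult_le_pos; [lra | exact: pos_INR].
have n_gt0 : 0 < INR #|T|.
  by apply: lt_0_INR; apply/ltP; apply/card_gt0P; exists v0.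
have xn_gt0 := Rmult_lt_0_compat _ _ x_gt0 n_gt0.
(* The smallest gap on [L] is a natural number valid for all of [L]; being attained at a low vertex,
   it still exceeds [2xn]. *)
pose w := [arg min_(v < v0 in L) (#|T| - 2 * degree e v)%nat].
have [wL w_min] : w \in L /\ forall v, v \in L ->
    (#|T| - 2 * degree e w <= #|T| - 2 * degree e v)%nat.
  by rewrite /w; case: arg_minnP.
have low_nat v : v \in L -> (2 * degree e v <= #|T|)%nat.
  move=> /low lt_v; apply/leP; apply: INR_le; rewrite mult_INR [INR 2]/=; lra.
set g := (#|T| - 2 * degree e w)%nat in w_min.
have g_ge : 2 * x * INR #|T| < INR g.
  rewrite /g minus_INR; last by apply/leP; exact: low_nat.
  by rewrite mult_INR [INR 2]/=; have := low w wL; lra.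
have low_g v : v \in L -> (2 * degree e v + g <= #|T|)%nat.
  by move=> vL; have := w_min v vL; have := low_nat v vL; lia.
have /leP/le_INR := low_degree_bound simple_e le_bn low_g.
rewrite plus_INR !mult_INR [INR 4]/=; move: m_ge g_ge (pos_INR #|L|) n_gt0 xn_gt0.
move: (INR g) (INR #|L|) (INR #|T|) (INR (num_edges e)) => G l n m.
move=> m_ge g_ge l_ge0 n_gt0 xn_gt0 le_n3.
have nm_ge : n * m >= n * ((/ 4 - x ^ 3) * n ^ 2) by nra.
have gg_ge : (2 * x * n) * (2 * x * n) <= G * G by nra.
have l_le : (2 * x * n) * (2 * x * n) * l <= 4 * x ^ 3 * n ^ 3.
  have := Rmult_le_compat_r l _ _ l_ge0 gg_ge; lra.
have xn2_gt0 : 0 < (2 * x * n) * (2 * x * n) by nra.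
by apply: (Rmult_le_reg_l _ _ _ xn2_gt0); lra.
Qed.

Theorem theorem6 (alpha : R) (T : finType) (e : rel T) :
  simple_graph e ->
  0 < alpha -> alpha < / 100000 ->
  INR (num_edges e) >= (/ 4 - alpha) * (INR #|T|) ^ 2 ->
  INR (booksize e) > (/ 6 - 2 * Rpower alpha (/ 3)) * INR #|T|
  \/
  exists S : {set T},
    induced_bipartite e S /\
    INR #|S| >= (1 - Rpower alpha (/ 3)) * INR #|T| /\
    (forall v, v \in S ->
       INR (induced_deg e S v) >= (/ 2 - 4 * Rpower alpha (/ 3)) * INR #|T|).
Proof.
move=> simple_e alpha_gt0 alpha_lt; have [sym_e _] := simple_e.
have x_gt0 : 0 < Rpower alpha (/ 3) by exact: exp_pos.
have := Rpower_third_pow3 alpha_gt0.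
move: (Rpower alpha (/ 3)) x_gt0 => x x_gt0 x3 m_ge.
(* At [x = 1/28] the degree bound [1/2 - 2x] is exactly 3/7, and [28^3 = 21952 < 10^5]. *)
have x_lt : x < / 28.
  apply: Rnot_le_lt => x_ge; have := pow_incr (/ 28) x 3; lra.
case: (Rlt_le_dec ((/ 6 - 2 * x) * INR #|T|) (INR (booksize e))) => bk_le.
  by left.
right; have n_ge0 := pos_INR #|T|.
have le_bn : (6 * booksize e <= #|T|)%nat.
  by apply/leP; apply: INR_le; rewrite mult_INR [INR 6]/=; nra.
pose low v := if Rlt_dec (INR (degree e v)) ((/ 2 - x) * INR #|T|)
  then true else false.
pose L := [set v | low v].
have L_le : INR #|L| <= x * INR #|T|.
  apply: (@few_low_degrees _ e) => //; first by rewrite x3.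
  by move=> v; rewrite inE /low; case: Rlt_dec.
have high v : v \in ~: L -> (/ 2 - x) * INR #|T| <= INR (degree e v).
  by rewrite !inE /low; case: Rlt_dec => // nlt _; exact: Rnot_lt_le.
have card_compl : INR #|L| + INR #|~: L| = INR #|T|.
  by rewrite -plus_INR; congr INR; exact: cardsC.
have deg_ge v : v \in ~: L ->
    (/ 2 - 2 * x) * INR #|T| <= INR (induced_deg e (~: L) v).
  move=> /high; suff le_deg : (degree e v <= #|L| + induced_deg e (~: L) v)%nat.
    by have /leP/le_INR := le_deg; rewrite plus_INR; lra.
  rewrite -leq_subLR /degree -(cardsID L) leq_subLR leq_add //.
    by apply: subset_leq_card; exact: subsetIr.
  by apply: subset_leq_card; apply/subsetP => w; rewrite !inE.
exists (~: L); split; [|split; [lra|]]; last first.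
  by move=> v /deg_ge; nra.
apply: dense_triangle_free_bipartite => // [u v w uM vM wM euv euw evw | v vM].
(* The three codegrees add up to at least [(1/2 - 3x) n], but to at most [3b <= (1/2 - 6x) n]. *)
- have /leP/le_INR := codegree_triple_ge e u v w; rewrite !plus_INR.
  have /leP/le_INR := codegree_le_booksize euv.
  have /leP/le_INR := codegree_le_booksize euw.
  have /leP/le_INR := codegree_le_booksize evw.
  have n_gt0 : 0 < INR #|T|.
    by apply: lt_0_INR; apply/ltP; apply/card_gt0P; exists u.
  have := high u uM; have := high v vM; have := high w wM; nra.
- have n_gt0 : 0 < INR #|T|.
    by apply: lt_0_INR; apply/ltP; apply/card_gt0P; exists v.
  apply/ltP; apply: INR_lt; rewrite !mult_INR [INR 3]/= [INR 7]/=.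
  have := deg_ge v vM; have := pos_INR #|L|; nra.
Qed.
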